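(* Suppose $F(\theta)=\theta^{1/\delta}$ on $[0,1]$ for some $\delta>0$, $C^P(q,\theta)=\theta^{E_P}g_1(q)$ and the investment costs are $C^I(q,\theta)=\beta\,\theta^{E_I}g_2(q)$, where $E_P,E_I>0$ and $\beta>0$. Let $s^*$ be the optimal scoring function (depending on $n$ and $\beta$). Then: 1. If $E_P<E_I$, then $s^{*\prime}(q)$ decreases in $n$ and in $\beta$ at every $q$. 2. If $E_P>E_I$, then $s^{*\prime}(q)$ increases in $n$ and in $\beta$ at every $q$. (Here $q$ ranges over qualities in the range $q^*_{sym}((0,1))$ for the parameter values compared.)
   Context: Setting. There are $n\ge2$ firms with i.i.d. types in $[0,1]$ with cdf $F$ and density $f$; $V$ is the buyer's value of quality, with $V'\ge0$, $V''\le0$; $C^P$ are production (winner-pay) and $C^I$ investment (all-pay) costs. Virtual costs: $\tilde C^P=C^P+C^P_\theta F/f$, $\tilde C^I=C^I+C^I_\theta F/f$; here $\tilde C^P=(1+\delta E_P)\theta^{E_P}g_1(q)$ and $\tilde C^I=\beta(1+\delta E_I)\theta^{E_I}g_2(q)$. The functions $g_1,g_2$ are smooth and well-behaved, meaning that the standing assumptions of the model hold: for $q>0$, $g_1,g_2>0$, $g_1',g_2'>0$, $g_1'',g_2''>0$; $g_2(0)=g_2'(0)=0$; and for every $\theta\in(0,1)$, $V'(0)>\tilde C^P_q(0,\theta)$ and $V'(q)<\tilde C^P_q(q,\theta)+\tilde C^I_q(q,\theta)$ for all large $q$. Optimal symmetric quality function: for $\theta\in(0,1)$, $q=q^*_{sym}(\theta)$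 solves $V'(q)=\tilde C^P_q(q,\theta)+\tilde C^I_q(q,\theta)/(1-F(\theta))^{n-1}$; it is decreasing in $\theta$, with inverse $\theta(q)$. Optimal scoring function: $s^*$ satisfies $s^{*\prime}(q)=C^P_q(q,\theta(q))+C^I_q(q,\theta(q))/(1-F(\theta(q)))^{n-1}$ on the range of $q^*_{sym}$. *)

(* Defs.v *)
From mathcomp Require Import all_boot all_order all_algebra.
From mathcomp Require Import all_classical all_reals all_analysis.

Set Implicit Arguments.
Unset Strict Implicit.
Unset Printing Implicit Defensive.

Import Order.TTheory GRing.Theory Num.Theory.
Import numFieldNormedType.Exports.

Local Open Scope classical_set_scope.
Local Open Scope ring_scope.

(* Conventions. A cost is a function C : R -> R -> R of (quality, type).
   Types live in [0, 1] and qualities in [0, +oo[. Functions of quality are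
   total on R but are only constrained on [0, +oo[. Derivatives in quality at 0
   are the ordinary two-sided ones: a function that is smooth (or twice
   differentiable) up to the boundary of [0, +oo[ extends past 0 with the same
   regularity, and the values at negative qualities play no role. *)

Section Model.
Context {R : realType}.
Implicit Types (F f V g s : R -> R) (C : R -> R -> R) (q t : R) (n : nat).

Definition dquality C q t : R := derive1 (C ^~ t) q.
Definition dtype C q t : R := derive1 (C q) t.

Definition virtual_cost F f C : R -> R -> R :=
  fun q t => C q t + dtype C q t * (F t / f t).

(* powR satisfies 0 `^ a = 0 for a != 0, so these formulas are the intended
   ones on the closed type interval. *)
Definition power_cdf (delta : R) F : Prop :=
  forall t, 0 <= t <= 1 -> F t = t `^ (1 / delta).

(* The version of the density that is the pointwise derivative of the cdf. *)
Definition density_of F f : Prop :=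
  forall t, 0 < t < 1 -> is_derive t 1 F (f t).

Definition production_cost (E_P : R) g : R -> R -> R :=
  fun q t => t `^ E_P * g q.

Definition investment_cost (beta E_I : R) g : R -> R -> R :=
  fun q t => beta * t `^ E_I * g q.

Definition smooth_ge0 g : Prop :=
  forall (k : nat) q, 0 <= q -> derivable (derive1n k g) q 1.

Record buyer_value V : Prop := {
  value_derivable : forall q, 0 <= q -> derivable V q 1;
  value_derivable2 : forall q, 0 <= q -> derivable (derive1 V) q 1;
  value_d1_ge0 : forall q, 0 <= q -> 0 <= derive1 V q;
  value_d2_le0 : forall q, 0 <= q -> derive1 (derive1 V) q <= 0 }.

Record well_behaved F f V (g1 g2 : R -> R) (CP CI : R -> R -> R) : Prop := {
  g1_smooth : smooth_ge0 g1;
  g2_smooth : smooth_ge0 g2;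
  g1_pos : forall q, 0 < q ->
    [/\ 0 < g1 q, 0 < derive1 g1 q & 0 < derive1 (derive1 g1) q];
  g2_pos : forall q, 0 < q ->
    [/\ 0 < g2 q, 0 < derive1 g2 q & 0 < derive1 (derive1 g2) q];
  g2_at0 : g2 0 = 0;
  g2_d1_at0 : derive1 g2 0 = 0;
  low_quality : forall t, 0 < t < 1 ->
    dquality (virtual_cost F f CP) 0 t < derive1 V 0;
  high_quality : forall t, 0 < t < 1 -> \forall q \near +oo,
    derive1 V q < dquality (virtual_cost F f CP) q t
              + dquality (virtual_cost F f CI) q t }.

Definition optimal_quality F f V (CP CI : R -> R -> R) n (qs : R -> R) : Prop :=
  forall t, 0 < t < 1 -> 0 <= qs t /\
    derive1 V (qs t) = dquality (virtual_cost F f CP) (qs t) t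
      + dquality (virtual_cost F f CI) (qs t) t / (1 - F t) ^+ (n - 1).

Definition quality_range (qs : R -> R) : set R := qs @` [set t | 0 < t < 1].

(* th is the inverse function of qs : ]0, 1[ -> quality_range qs. *)
Definition inverse_quality (qs th : R -> R) : Prop :=
  forall t, 0 < t < 1 -> th (qs t) = t.

Definition optimal_scoring F (CP CI : R -> R -> R) n (qs th s : R -> R) : Prop :=
  forall q, quality_range qs q ->
    is_derive q 1 s
      (dquality CP q (th q) + dquality CI q (th q) / (1 - F (th q)) ^+ (n - 1)).

End Model.

(* Main.v *)
(* Fix a quality q and let t be the type producing it.  With A = t^E_P g1'(q)
   and B = beta t^E_I g2'(q) / (1 - F t)^(n-1), the first-order condition reads
   V'(q) = (1 + delta E_P) A + (1 + delta E_I) B, while s*'(q) = A + B; hence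
   (1 + delta E_I) s*'(q) = V'(q) + delta (E_I - E_P) t^E_P g1'(q).
   The right-hand side of the first-order condition increases in t, n and beta,
   so at fixed q the type t decreases in n and beta, and the sign of E_I - E_P
   decides the direction in which s*'(q) moves. *)

Require Import Defs.
From mathcomp Require Import all_boot all_order all_algebra.
From mathcomp Require Import all_classical all_reals all_analysis.
From mathcomp Require Import ring.

Set Implicit Arguments.
Unset Strict Implicit.
Unset Printing Implicit Defensive.

Import Order.TTheory GRing.Theory Num.Theory.
Import numFieldNormedType.Exports.

Local Open Scope classical_set_scope.
Local Open Scope ring_scope.

Section PowerCosts.
Context {R : realType}.
Implicit Types (F f g V : R -> R) (b c delta E q t x y v p A B : R) (n m : nat).

(** * Marginal and virtual costs for power types *)

Lemma smooth_ge0_derivable g q : smooth_ge0 g -> 0 <= q -> derivable g q 1.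
Proof. by move=> /(_ 0%N q). Qed.

(** Lets each formula for investment costs serve for production costs too, with coefficient 1. *)
Lemma production_costE E g : production_cost E g = investment_cost 1 E g.
Proof. by apply/funext => q; apply/funext => t; rewrite /investment_cost mul1r. Qed.

Lemma dquality_investment_cost b E g q t : derivable g q 1 ->
  dquality (investment_cost b E g) q t = b * t `^ E * derive1 g q.
Proof. by move=> dg; rewrite /dquality /investment_cost derive1Ml. Qed.

Lemma dtype_investment_cost b E g q t : 0 < t ->
  dtype (investment_cost b E g) q t = b * (E * t `^ (E - 1)) * g q.
Proof.
move=> t0; have dt : is_derive t 1 (fun x => x `^ E) (E * t `^ (E - 1)).
  exact: is_derive1_powR.
rewrite /dtype /investment_cost derive1Mr; last exact/derivableM/ex_derive.
by rewrite derive1Ml ?derive1E ?derive_val//; exact: ex_derive.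
Qed.

Lemma power_cdf_density F f delta t : power_cdf delta F -> density_of F f ->
  0 < t < 1 -> f t = 1 / delta * t `^ (1 / delta - 1).
Proof.
move=> cdfF denF t01; have [dF FE] := denF t t01.
have t0 : 0 < t by case/andP: t01.
have dt : is_derive t 1 F (1 / delta * t `^ (1 / delta - 1)).
  (* [F] is known to be a power only on the unit interval, so the derivative is transferred from a
     neighbourhood of [t] inside it. *)
  apply: near_eq_is_derive (is_derive1_powR (1 / delta) t0).
  have /near_in_itvoo : t \in `]0, 1[ by rewrite in_itv.
  apply: filterS => x; rewrite in_itv /= => /andP[x0 x1].
  by rewrite cdfF// !ltW.
by rewrite -FE derive_val.
Qed.

Lemma power_cdf_hazard F f delta t : 0 < delta ->
  power_cdf delta F -> density_of F f -> 0 < t < 1 -> F t / f t = delta * t.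
Proof.
move=> d0 cdfF denF t01; have /andP[t0 t1] := t01.
rewrite (power_cdf_density cdfF denF t01) cdfF ?ltW//.
rewrite -(mulr_powRB1 (ltW t0) (_ : 0 < 1 / delta)) ?divr_gt0//.
have : t `^ (1 / delta - 1) != 0 by rewrite gt_eqF// powR_gt0.
by move=> ?; field; rewrite gt_eqF.
Qed.

(** As [F t / f t = delta * t], the information rent is [delta * E] times the cost itself, so the
    virtual cost is a constant multiple of the cost. *)
Lemma dquality_virtual_investment_cost F f g delta b E q t : 0 < delta -> 0 < E ->
  power_cdf delta F -> density_of F f -> derivable g q 1 -> 0 < t < 1 ->
  dquality (virtual_cost F f (investment_cost b E g)) q t
    = (1 + delta * E) * (b * t `^ E * derive1 g q).
Proof.
move=> d0 E0 cdfF denF dg t01; have /andP[t0 _] := t01.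
rewrite mulrA -derive1Ml//; congr (derive1 _ q); apply/funext => x.
rewrite /virtual_cost dtype_investment_cost// (power_cdf_hazard d0 cdfF denF)//.
by rewrite /investment_cost -(mulr_powRB1 (ltW t0) E0); ring.
Qed.

(** * The weight on investment costs: monotonicity in type, [beta] and [n] *)

Definition investment_weight delta n b t := b / (1 - t `^ (1 / delta)) ^+ (n - 1).

Lemma power_survival_bounds delta t : 0 < delta -> 0 < t < 1 ->
  0 < 1 - t `^ (1 / delta) < 1.
Proof.
move=> d0 /andP[t0 t1]; rewrite subr_gt0 ltrBlDr ltrDl powR_gt0// andbT.
have e0 : 0 < 1 / delta by rewrite divr_gt0.
have := gt0_ltr_powR e0 (_ : t \in Num.nneg) (_ : 1 \in Num.nneg) t1.
by rewrite powR1 !nnegrE ler01 ltW//; exact.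
Qed.

Lemma investment_weight_gt0 delta n b t : 0 < delta -> 0 < b -> 0 < t < 1 ->
  0 < investment_weight delta n b t.
Proof.
move=> d0 b0 /(power_survival_bounds d0)/andP[p0 _].
by rewrite divr_gt0// exprn_gt0.
Qed.

Lemma investment_weight_le delta n b : 0 < delta -> 0 < b ->
  {in `]0, 1[ &, {homo investment_weight delta n b : x y / x <= y}}.
Proof.
move=> d0 b0 x y; rewrite !in_itv/= => x01 y01 xy.
have /andP[px _] := power_survival_bounds d0 x01.
have /andP[py _] := power_survival_bounds d0 y01.
have /andP[x0 _] := x01; have /andP[y0 _] := y01.
have pyx : 1 - y `^ (1 / delta) <= 1 - x `^ (1 / delta).
  by rewrite lerD2l lerN2 ge0_ler_powR ?nnegrE ?divr_ge0// ltW.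
rewrite ler_pM2l// lef_pV2 ?posrE ?exprn_gt0//.
by rewrite lerXn2r// nnegrE ltW.
Qed.

Lemma investment_weight_lt_beta delta n b c t : 0 < delta -> b < c -> 0 < t < 1 ->
  investment_weight delta n b t < investment_weight delta n c t.
Proof.
move=> d0 bc /(power_survival_bounds d0)/andP[p0 _].
by rewrite ltr_pM2r// invr_gt0 exprn_gt0.
Qed.

Lemma investment_weight_lt_firms delta n m b t : 0 < delta -> 0 < b ->
  (0 < n < m)%N -> 0 < t < 1 ->
  investment_weight delta n b t < investment_weight delta m b t.
Proof.
move=> d0 b0 nm /(power_survival_bounds d0)/andP[p0 p1].
rewrite ltr_pM2l// ltf_pV2 ?posrE ?exprn_gt0//.
(* Subtraction on naturals is truncated; [0 < n] ensures [n - 1 < m - 1]. *)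
by rewrite ltr_iXn2l//; case: n m nm => [|n] [|m]//=; rewrite !subn1.
Qed.

(** * Comparative statics at a fixed quality *)

(* First-order condition and slope [p] = s*'(q) at the type [t] producing q, with
   A = g1'(q), B = g2'(q), v = V'(q), E = E_P and E' = E_I.  The number of
   firms and beta enter only through the weight [w] on investment costs. *)
Definition scoring_slope delta E E' A B v (w : R -> R) t p : Prop :=
  [/\ 0 < t < 1, 0 < w t,
      v = (1 + delta * E) * (t `^ E * A) + (1 + delta * E') * (w t * t `^ E' * B) &
      p = t `^ E * A + w t * t `^ E' * B].

(** If [t <= t'], both terms of the first-order condition would be at least as large under [w'] at
    [t'], the investment term strictly, yet both sums equal [v]. *)
Lemma scoring_slope_type_lt delta E E' A B v (w w' : R -> R) t t' p p' :
  0 < delta -> 0 < E -> 0 < E' -> 0 < A -> 0 < B ->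
  {in `]0, 1[ &, {homo w : x y / x <= y}} ->
  (forall x, 0 < x < 1 -> w x < w' x) ->
  scoring_slope delta E E' A B v w t p ->
  scoring_slope delta E E' A B v w' t' p' -> t' < t.
Proof.
move=> d0 E0 E'0 A0 B0 wle ww' [t01 wt0 foc _] [t'01 w't0 foc' _].
rewrite ltNge; apply/negP => tt'.
have [/andP[t0 _] /andP[t'0 _]] := (t01, t'01).
have powle e : 0 < e -> t `^ e <= t' `^ e.
  by move=> e0; rewrite ge0_ler_powR ?nnegrE// ltW.
have wtt' : w t < w' t' by apply: le_lt_trans (ww' _ t'01); apply: wle.
have : v < v; last by rewrite ltxx.
rewrite {1}foc foc'; apply: ler_ltD.
  by rewrite ler_pM2l ?addr_gt0 ?mulr_gt0// ler_pM2r// powle.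
rewrite ltr_pM2l ?addr_gt0 ?mulr_gt0// ltr_pM2r//.
(* The weight is raised first, then the power of the type. *)
apply: lt_le_trans (_ : w' t' * t `^ E' <= _).
  by rewrite ltr_pM2r// powR_gt0.
by rewrite ler_pM2l// powle.
Qed.

(** Eliminating the investment term between the two equations leaves a formula in which the weight
    acts only through [t]. *)
Lemma scoring_slopeE delta E E' A B v (w : R -> R) t p :
  scoring_slope delta E E' A B v w t p ->
  (1 + delta * E') * p = v + delta * (E' - E) * (t `^ E * A).
Proof. by move=> [_ _ -> ->]; ring. Qed.

Lemma scoring_slope_compare delta E E' A B v (w w' : R -> R) t t' p p' :
  0 < delta -> 0 < E -> 0 < E' -> 0 < A -> 0 < B ->
  {in `]0, 1[ &, {homo w : x y / x <= y}} ->
  (forall x, 0 < x < 1 -> w x < w' x) ->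
  scoring_slope delta E E' A B v w t p ->
  scoring_slope delta E E' A B v w' t' p' ->
  (E < E' -> p' < p) /\ (E' < E -> p < p').
Proof.
move=> d0 E0 E'0 A0 B0 wle ww' S S'.
have tt' := scoring_slope_type_lt d0 E0 E'0 A0 B0 wle ww' S S'.
have [[/andP[t0 _] _ _ _] [/andP[t'0 _] _ _ _]] := (S, S').
have pow_lt : t' `^ E * A < t `^ E * A.
  by rewrite ltr_pM2r// gt0_ltr_powR ?nnegrE ?ltW.
have c0 : 0 < 1 + delta * E' by rewrite addr_gt0 ?mulr_gt0.
split=> EE'; rewrite -(ltr_pM2l c0) (scoring_slopeE S) (scoring_slopeE S').
  by rewrite ltrD2l ltr_pM2l// mulr_gt0// subr_gt0.
by rewrite ltrD2l ltr_nM2l// pmulr_rlt0// subr_lt0.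
Qed.

(** * From the model to the slope equations *)

(** At quality 0 the investment term vanishes because [g2'(0) = 0], and the first-order condition
    would contradict [low_quality]. Positivity of the quality makes the signs of [g1'] and [g2']
    available. *)
Lemma optimal_quality_gt0 F f V g1 g2 delta E E' b n (qs : R -> R) t :
  0 < delta -> 0 < E' -> power_cdf delta F -> density_of F f ->
  well_behaved F f V g1 g2 (production_cost E g1) (investment_cost b E' g2) ->
  optimal_quality F f V (production_cost E g1) (investment_cost b E' g2) n qs ->
  0 < t < 1 -> 0 < qs t.
Proof.
move=> d0 E'0 cdfF denF wb opt t01; have [qs0 foc] := opt t t01.
rewrite lt_neqAle qs0 andbT; apply/eqP => q0.
have := low_quality wb t01; rewrite -q0 in foc; rewrite foc.
rewrite (dquality_virtual_investment_cost b d0 E'0 cdfF denF _ t01); last first.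
  exact: smooth_ge0_derivable (g2_smooth wb) (lexx 0).
by rewrite (g2_d1_at0 wb) !mulr0 mul0r addr0 ltxx.
Qed.

Lemma optimal_scoring_slope F f V g1 g2 delta E E' b n (qs th s : R -> R) q :
  0 < delta -> 0 < E -> 0 < E' -> 0 < b ->
  power_cdf delta F -> density_of F f ->
  well_behaved F f V g1 g2 (production_cost E g1) (investment_cost b E' g2) ->
  optimal_quality F f V (production_cost E g1) (investment_cost b E' g2) n qs ->
  inverse_quality qs th ->
  optimal_scoring F (production_cost E g1) (investment_cost b E' g2) n qs th s ->
  quality_range qs q ->
  0 < q /\ exists t, scoring_slope delta E E' (derive1 g1 q) (derive1 g2 q)
    (derive1 V q) (investment_weight delta n b) t (derive1 s q).
Proof.
move=> d0 E0 E'0 b0 cdfF denF wb opt inv sco qr; have ds := sco _ qr.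
(* The witness is the type that produces [q]; [inverse_quality] identifies it with [th q]. *)
case: qr ds => t /= t01 <- ds.
have q0 := optimal_quality_gt0 d0 E'0 cdfF denF wb opt t01.
split=> //; exists t; have [_ foc] := opt t t01.
have dg1 : derivable g1 (qs t) 1 by exact: smooth_ge0_derivable (g1_smooth wb) (ltW q0).
have dg2 : derivable g2 (qs t) 1 by exact: smooth_ge0_derivable (g2_smooth wb) (ltW q0).
have FE : F t = t `^ (1 / delta) by apply: cdfF; case/andP: t01 => *; rewrite !ltW.
split => //; first exact: investment_weight_gt0.
  rewrite foc production_costE FE.
  rewrite !(dquality_virtual_investment_cost _ d0 _ cdfF denF)//.
  by rewrite /investment_weight; ring.
rewrite derive1E (derive_val (is_derive := ds)) inv// production_costE FE.
by rewrite !dquality_investment_cost// /investment_weight; ring.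
Qed.

End PowerCosts.

Theorem proposition5 (R : realType) (V g1 g2 F f : R -> R) (delta E_P E_I : R)
    (q_sym theta s : nat -> R -> R -> R) :
  let CP := production_cost E_P g1 in
  let CI := fun beta : R => investment_cost beta E_I g2 in
  let admissible := fun beta : R =>
    0 < beta /\ well_behaved F f V g1 g2 CP (CI beta) in
  let in_range := fun (n : nat) (beta q : R) =>
    quality_range (q_sym n beta) q in
  0 < delta -> 0 < E_P -> 0 < E_I ->
  power_cdf delta F -> density_of F f -> buyer_value V ->
  (forall (n : nat) (beta : R), (2 <= n)%N -> admissible beta ->
    [/\ optimal_quality F f V CP (CI beta) n (q_sym n beta),
        inverse_quality (q_sym n beta) (theta n beta) &
        optimal_scoring F CP (CI beta) n
          (q_sym n beta) (theta n beta) (s n beta)]) ->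
  (E_P < E_I ->
    (forall (n m : nat) (beta q : R),
      (2 <= n)%N -> (n < m)%N -> admissible beta ->
      in_range n beta q -> in_range m beta q ->
      derive1 (s m beta) q < derive1 (s n beta) q) /\
    (forall (n : nat) (beta beta' q : R),
      (2 <= n)%N -> beta < beta' -> admissible beta -> admissible beta' ->
      in_range n beta q -> in_range n beta' q ->
      derive1 (s n beta') q < derive1 (s n beta) q)) /\
  (E_I < E_P ->
    (forall (n m : nat) (beta q : R),
      (2 <= n)%N -> (n < m)%N -> admissible beta ->
      in_range n beta q -> in_range m beta q ->
      derive1 (s n beta) q < derive1 (s m beta) q) /\
    (forall (n : nat) (beta beta' q : R),
      (2 <= n)%N -> beta < beta' -> admissible beta -> admissible beta' ->
      in_range n beta q -> in_range n beta' q ->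
      derive1 (s n beta) q < derive1 (s n beta') q)).
Proof.
move=> CP CI admissible in_range d0 EP0 EI0 cdfF denF _ opt.
have slope n beta q : (2 <= n)%N -> admissible beta -> in_range n beta q ->
    [/\ 0 < derive1 g1 q, 0 < derive1 g2 q & exists t,
      scoring_slope delta E_P E_I (derive1 g1 q) (derive1 g2 q) (derive1 V q)
        (investment_weight delta n beta) t (derive1 (s n beta) q)].
  move=> n2 adm qr; have [oq iq os] := opt n beta n2 adm.
  have [b0 wb] := adm.
  have [q0 [t St]] :=
    optimal_scoring_slope d0 EP0 EI0 b0 cdfF denF wb oq iq os qr.
  have [_ A0 _] := g1_pos wb q0; have [_ B0 _] := g2_pos wb q0.
  by split=> //; exists t.
(* At a common [q] the values [g1'(q)], [g2'(q)] and [V'(q)] are the same for [n] and [m], so the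
   two slopes differ only through weight and type. *)
have firms n m beta q : (2 <= n)%N -> (n < m)%N -> admissible beta ->
    in_range n beta q -> in_range m beta q ->
    (E_P < E_I -> derive1 (s m beta) q < derive1 (s n beta) q) /\
    (E_I < E_P -> derive1 (s n beta) q < derive1 (s m beta) q).
  move=> n2 nm adm qn qm; have b0 := adm.1.
  have [A0 B0 [t St]] := slope _ _ _ n2 adm qn.
  have [_ _ [t' St']] := slope _ _ _ (leq_trans n2 (ltnW nm)) adm qm.
  have wle := investment_weight_le n d0 b0.
  apply: (scoring_slope_compare d0 EP0 EI0 A0 B0 wle _ St St') => x.
  by apply: investment_weight_lt_firms => //; rewrite nm ltnW.
(* The same comparison, with the weight now raised through [beta]. *)
have betas n beta beta' q : (2 <= n)%N -> beta < beta' ->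
    admissible beta -> admissible beta' ->
    in_range n beta q -> in_range n beta' q ->
    (E_P < E_I -> derive1 (s n beta') q < derive1 (s n beta) q) /\
    (E_I < E_P -> derive1 (s n beta) q < derive1 (s n beta') q).
  move=> n2 bb' adm adm' qn qn'; have b0 := adm.1.
  have [A0 B0 [t St]] := slope _ _ _ n2 adm qn.
  have [_ _ [t' St']] := slope _ _ _ n2 adm' qn'.
  have wle := investment_weight_le n d0 b0.
  apply: (scoring_slope_compare d0 EP0 EI0 A0 B0 wle _ St St') => x.
  exact: investment_weight_lt_beta.
by split=> EE; split=> *;
  [apply: (firms _ _ _ _ _ _ _ _ _).1 | apply: (betas _ _ _ _ _ _ _ _ _ _).1
  |apply: (firms _ _ _ _ _ _ _ _ _).2 | apply: (betas _ _ _ _ _ _ _ _ _ _).2].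
Qed.
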